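(* Let $G$ be a finite group and $H\leq G$ a subgroup. Put $H^c:=G\setminus H$ and $\mathcal{C}^{(-1)}(H):=G$, fix $g_0\in G$, and construct sequences $\{g_n\}_{n\geq 0}$ and $\{\mathcal{C}^{(n)}(H)\}_{n\geq -1}$ as follows (procedure RTA). If $g_0,\dots,g_n$ and $\mathcal{C}^{(-1)}(H),\dots,\mathcal{C}^{(n-1)}(H)$ have been defined for an integer $n\geq 0$, set $$\mathcal{C}^{(n)}(H):=\mathcal{C}^{(n-1)}(H)\cap H^c g_n,$$ and then, if $\mathcal{C}^{(n)}(H)$ is nonempty, choose an (arbitrary) element $g_{n+1}\in\mathcal{C}^{(n)}(H)$ and put $B_n:=\{g_0,\dots,g_{n+1}\}$; also $B_{-1}:=\{g_0\}$. (Thus $\mathcal{C}^{(n)}(H)=\bigcap_{i=0}^{n}H^cg_i$ for all $n\ge 0$.) Then, for any choices made in the procedure, there exists a least integer $N\geq 0$ such that $\mathcal{C}^{(N)}(H)=\emptyset$, we have $|G:H|=N+1$, and $B:=B_{N-1}$ (which has $N+1$ elements) is a right transversal of $H$ in $G$. Moreover, every right transversal of $H$ in $G$ can be obtained from this procedure, i.e. it equals the output $B_{N-1}$ for some admissible choice of $g_0,g_1,\dots,g_N$.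
   Context: A right transversal of $H$ in $G$ is a subset $T\subseteq G$ containing exactly one element of each right coset $Hg$, $g\in G$ (so $G$ is the disjoint union of the cosets $Ht$, $t\in T$). For $S\subseteq G$ and $g\in G$, $Sg=\{sg: s\in S\}$. *)

(* Defs.v *)
From mathcomp Require Import all_boot all_fingroup.

Set Implicit Arguments.
Unset Strict Implicit.
Unset Printing Implicit Defensive.

Import GroupScope.

Section RTA.

Variables (gT : finGroupType) (G H : {group gT}).

Definition right_transversal (T : {set gT}) : bool :=
  is_transversal T (rcosets H G) G.

(* Indices are shifted by one: RTA_C g n is C^(n-1)(H), so that RTA_C g 0 is  *)
(* C^(-1)(H) = G, and RTA_C g n.+1 is C^(n)(H).                               *)
Fixpoint RTA_C (g : nat -> gT) (n : nat) : {set gT} :=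
  if n is m.+1 then RTA_C g m :&: (G :\: H) :* g m else G.

(* The choices g_0, g_1, ... are given by a total function g: as long as the  *)
(* procedure has not stopped, the next value must lie in the last set C^(n);  *)
(* once some C^(n) is empty, later values of g are unconstrained, and they    *)
(* play no role since every later C^(m) is empty too.                         *)
Definition RTA_run (g : nat -> gT) : Prop :=
  g 0 \in G /\
  forall n, RTA_C g n.+1 != set0 -> g n.+1 \in RTA_C g n.+1.

(* N is the least natural number such that C^(N)(H) is empty. *)
Definition RTA_stop (g : nat -> gT) (N : nat) : Prop :=
  RTA_C g N.+1 = set0 /\ forall n, RTA_C g n.+1 = set0 -> N <= n.

(* Same shift: RTA_B g n is B_(n-1) = {g_0, ..., g_n}. *)
Definition RTA_B (g : nat -> gT) (n : nat) : {set gT} :=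
  [set g i | i : 'I_n.+1].

End RTA.

(* Main.v *)
Require Import Defs.
From mathcomp Require Import all_boot all_fingroup.

Set Implicit Arguments.
Unset Strict Implicit.
Unset Printing Implicit Defensive.

Import GroupScope.

(** As long as the chosen elements lie in G, the set C^(n) consists of the
elements of G outside the cosets H g_0, ..., H g_n.  So each choice opens a new
coset, and C^(n) is empty exactly when all cosets have been met.  Conversely,
the elements of a transversal can be chosen one by one, in any order. *)

Section RightTransversal.

Variables (gT : finGroupType) (G H : {group gT}).

(** Pointwise form, so that the rest can argue with elements instead of blocks of the coset
    partition. *)
Lemma right_transversalP (T : {set gT}) : H \subset G ->
  reflect [/\ T \subset G,
              {in T &, forall s t, s \in H :* t -> s = t}
            & forall x, x \in G -> exists2 t, t \in T & x \in H :* t]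
          (right_transversal G H T).
Proof.
move=> sHG; rewrite /right_transversal /is_transversal rcosets_partition //=.
apply: (iffP andP) => [[sTG /forall_inP oneT] | [sTG injT covT]].
  have meetT x : x \in G -> exists t, T :&: H :* x = [set t].
    by move=> Gx; apply/cards1P/oneT/rcosetsP; exists x.
  split=> // [s t Ts Tt Hts | x /meetT[t defTx]].
    have [u defTt] := meetT t (subsetP sTG t Tt).
    have /set1P-> : s \in [set u] by rewrite -defTt inE Ts.
    by apply/esym/set1P; rewrite -defTt inE Tt rcoset_refl.
  have: t \in T :&: H :* x by rewrite defTx set11.
  by rewrite inE rcoset_sym => /andP[Tt]; exists t.
split=> //; apply/forall_inP=> _ /rcosetsP[x Gx ->].
have [t Tt Htx] := covT x Gx; apply/cards1P; exists t.
apply/setP=> s; rewrite (rcoset_eqP Htx) !inE.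
apply/andP/eqP=> [[Ts] | ->]; first exact: injT.
by rewrite rcoset_refl.
Qed.

Lemma card_right_transversal (T : {set gT}) :
  right_transversal G H T -> #|T| = #|G : H|.
Proof. exact: card_transversal. Qed.

End RightTransversal.

Section Procedure.

Variables (gT : finGroupType) (G H : {group gT}) (g : nat -> gT).

Lemma RTA_C_sub m n : m <= n -> RTA_C G H g n \subset RTA_C G H g m.
Proof.
elim: n => [|n IHn]; first by rewrite leqn0 => /eqP->.
rewrite leq_eqVlt => /predU1P[-> // | /IHn]; apply: subset_trans.
exact: subsetIl.
Qed.

Lemma RTA_C_bigcap n : g 0 \in G ->
  RTA_C G H g n.+1 = \bigcap_(i < n.+1) ((G :\: H) :* g i).
Proof.
move=> Gg0; elim: n => [|n IHn]; last by rewrite big_ord_recr -IHn.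
(* The initial factor [G] is absorbed: [g 0] lies in [G], hence so does all of
   [(G :\: H) :* g 0]. *)
rewrite big_ord1 /=; apply/setIidPr/subsetP=> x.
by rewrite mem_rcoset inE (groupMr _ (groupVr Gg0)) => /andP[].
Qed.

(** For [a] in [G], the translate [(G :\: H) :* a] is [G] minus the coset [H :* a]. Only indices
    below [n] are constrained, since a run may leave [G] after it has stopped. *)
Lemma RTA_C_P n x : (forall i, i < n -> g i \in G) ->
  reflect (x \in G /\ forall i, i < n -> x \notin H :* g i)
          (x \in RTA_C G H g n).
Proof.
elim: n => [|n IHn] Gg; first by apply: (iffP idP) => // -[].
have Ggn := Gg n (ltnSn n).
rewrite /= inE mem_rcoset inE -mem_rcoset.
apply: (iffP and3P) => [[/IHn[i /ltnW/Gg //|Gx xNg] xNgn _] | [Gx xNg]].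
  by split=> // i; rewrite ltnS leq_eqVlt => /predU1P[-> | /xNg].
split; [apply/IHn | exact: xNg | by rewrite groupMr ?groupV].
  by move=> i /ltnW/Gg.
by split=> // i /ltnW/xNg.
Qed.

(** The sets decrease, so all those before a nonempty one are nonempty, and the run condition
    applies to each. *)
Lemma RTA_run_mem n : RTA_run G H g -> RTA_C G H g n != set0 ->
  forall i, i <= n -> g i \in RTA_C G H g i.
Proof.
move=> [Gg0 g_run] nzC [//|i] le_i_n; apply: g_run.
by apply: contraNneq nzC => Ci0; rewrite -subset0 -Ci0 RTA_C_sub.
Qed.

Lemma RTA_B_P n x : reflect (exists2 i, i <= n & x = g i) (x \in RTA_B g n).
Proof.
apply: (iffP imsetP) => [[i _ ->] | [i le_i_n ->]].
  by exists (i : nat); rewrite ?leq_ord.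
by exists (Ordinal (le_i_n : i < n.+1)).
Qed.

Section FullRun.

Variable N : nat.
(** This holds for a run up to its stop, for a supposedly too long run, and for an enumeration of a
    transversal; the section serves all three. *)
Hypothesis gC : forall i, i <= N -> g i \in RTA_C G H g i.

Lemma RTA_mem_G i : i <= N -> g i \in G.
Proof. by move/gC; apply/subsetP/(RTA_C_sub (leq0n i)). Qed.

(** Lying in the same coset is symmetric, so let [j < i]; then [g i] was chosen outside
    [H :* g j]. *)
Lemma RTA_rcoset_inj i j :
  i <= N -> j <= N -> g i \in H :* g j -> i = j.
Proof.
wlog lt_j_i: i j / j < i => [wlog_ij | le_i_N le_j_N Hij].
  move=> le_i_N le_j_N Hij; have [lt_i_j | lt_j_i | //] := ltngtP i j.
    by apply/esym/wlog_ij; rewrite // rcoset_sym.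
  exact: wlog_ij.
have Gg k : k < i -> g k \in G.
  by move=> lt_k_i; apply: RTA_mem_G (leq_trans (ltnW lt_k_i) le_i_N).
have /(RTA_C_P _ Gg)[_ /(_ j lt_j_i)] := gC le_i_N.
by rewrite Hij.
Qed.

Lemma card_RTA_B : #|RTA_B g N| = N.+1.
Proof.
rewrite card_imset ?card_ord // => i j gij; apply/val_inj/RTA_rcoset_inj.
- exact: leq_ord.
- exact: leq_ord.
by rewrite gij rcoset_refl.
Qed.

Lemma RTA_B_transversal : H \subset G -> RTA_C G H g N.+1 = set0 ->
  right_transversal G H (RTA_B g N).
Proof.
move=> sHG CN0; apply/right_transversalP => //; split.
- by apply/subsetP=> _ /RTA_B_P[i le_i_N ->]; apply: RTA_mem_G.
- move=> _ _ /RTA_B_P[i le_i_N ->] /RTA_B_P[j le_j_N ->] Hij.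
  by rewrite (RTA_rcoset_inj le_i_N le_j_N Hij).
move=> x Gx; have [/exists_inP[t]|] := boolP [exists t in RTA_B g N, x \in H :* t].
  by exists t.
rewrite negb_exists_in => /forall_inP noB.
(* An [x] in [G] missed by all cosets [H :* g i] would survive in the last set, which is empty. *)
have: x \in RTA_C G H g N.+1; last by rewrite CN0 inE.
apply/RTA_C_P=> [i|]; first by rewrite ltnS; apply: RTA_mem_G.
by split=> // i lt_i; apply/noB/RTA_B_P; exists i.
Qed.

Lemma RTA_stop_leq n : RTA_C G H g n.+1 = set0 -> N <= n.
Proof.
move=> Cn0; rewrite leqNgt; apply/negP=> lt_n_N.
by have:= gC lt_n_N; rewrite Cn0 inE.
Qed.

End FullRun.

Lemma RTA_run_stops : RTA_run G H g -> exists n, RTA_C G H g n.+1 == set0.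
Proof.
(* A crude bound suffices: a run still alive here would give [#|G| + 2] distinct elements of [G]. *)
move=> g_run; exists #|G|; apply/negPn/negP=> nzC.
have gC := RTA_run_mem g_run nzC.
have: RTA_B g #|G|.+1 \subset G.
  by apply/subsetP=> _ /RTA_B_P[i le_i ->]; apply: RTA_mem_G gC _ le_i.
by move/subset_leq_card; rewrite (card_RTA_B gC) ltnNge leqnSn.
Qed.

(** Makes [RTA_run_mem] applicable at the stopping index, so that the choices up to [g N] are all
    valid. *)
Lemma RTA_run_nonempty N : RTA_run G H g ->
  (forall n, RTA_C G H g n.+1 = set0 -> N <= n) -> RTA_C G H g N != set0.
Proof.
case=> Gg0 _; case: N => [|n] minN; first by apply/set0Pn; exists (g 0).
by apply/eqP=> /minN; rewrite ltnn.
Qed.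

End Procedure.

Lemma right_transversal_run (gT : finGroupType) (G H : {group gT})
    (T : {set gT}) : H \subset G -> right_transversal G H T ->
  exists (g : nat -> gT) (N : nat),
    [/\ RTA_run G H g, RTA_stop G H g N & RTA_B g N = T].
Proof.
move=> sHG /(right_transversalP _ sHG)[sTG injT covT].
have [t0 Tt0 _] := covT 1 (group1 G).
have [N cardT] : exists N, #|T| = N.+1.
  by exists #|T|.-1; rewrite prednK //; apply/card_gt0P; exists t0.
(* The default [1] is taken only beyond index [N], where the sets are already empty and impose no
   condition. *)
pose g := nth 1 (enum T); exists g, N.
have size_T : size (enum T) = N.+1 by rewrite -cardE.
have Tg i : i <= N -> g i \in T.
  by move=> le_i_N; rewrite -mem_enum mem_nth ?size_T.
have defB : RTA_B g N = T.
  apply/setP=> t; apply/RTA_B_P/idP=> [[i /Tg Tgi -> //] | Tt].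
  exists (index t (enum T)); last by rewrite /g nth_index ?mem_enum.
  by rewrite -ltnS -size_T index_mem mem_enum.
have Gg i : i <= N -> g i \in G by move/Tg/(subsetP sTG).
have gC i : i <= N -> g i \in RTA_C G H g i.
  move=> le_i_N; apply/RTA_C_P=> [j /ltnW lt_j_i | ].
    exact: Gg (leq_trans lt_j_i le_i_N).
  split=> [|j lt_j_i]; first exact: Gg.
  have le_j_N := leq_trans (ltnW lt_j_i) le_i_N.
  (* A common coset would force [g i = g j], but [enum T] has no repetitions. *)
  apply: contraL lt_j_i => /(injT _ _ (Tg i le_i_N) (Tg j le_j_N))/eqP.
  by rewrite nth_uniq ?size_T ?enum_uniq // => /eqP->; rewrite ltnn.
have CN0 : RTA_C G H g N.+1 = set0.
  apply/setP=> x; rewrite in_set0; apply/negP=> /RTA_C_P[// | Gx xNg].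
  have [t] := covT x Gx; rewrite -defB => /RTA_B_P[i le_i_N ->].
  by apply/negP/xNg.
split=> //; last by split=> // n; apply: RTA_stop_leq gC _.
split=> [|n nzC]; first exact: Gg.
(* For [N <= n] the set at [n.+1] sits inside the empty one at [N.+1], so a nonempty set means
   [n < N]. *)
apply: gC; rewrite ltnNge; apply: contra nzC => le_N_n.
by rewrite -subset0 -CN0 RTA_C_sub.
Qed.

Theorem theorem1p2 (gT : finGroupType) (G H : {group gT}) (sHG : H \subset G) :
  (forall g : nat -> gT, RTA_run G H g ->
     (forall n : nat, RTA_C G H g n.+1 = \bigcap_(i < n.+1) ((G :\: H) :* g i))
     /\ exists N : nat,
          [/\ RTA_stop G H g N,
              #|G : H| = N.+1,
              #|RTA_B g N| = N.+1
            & right_transversal G H (RTA_B g N)])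
  /\ (forall T : {set gT}, right_transversal G H T ->
        exists (g : nat -> gT) (N : nat),
          [/\ RTA_run G H g, RTA_stop G H g N & RTA_B g N = T]).
Proof.
split=> [g g_run | T]; last exact: right_transversal_run.
split=> [n|]; first by apply: RTA_C_bigcap; case: g_run.
have [N /eqP CN0 minN] := ex_minnP (RTA_run_stops g_run); exists N.
have{} minN n : RTA_C G H g n.+1 = set0 -> N <= n by move/eqP/minN.
have gC := RTA_run_mem g_run (RTA_run_nonempty g_run minN).
have trB := RTA_B_transversal gC sHG CN0.
by split; rewrite -?(card_right_transversal trB) ?(card_RTA_B gC).
Qed.
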